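(* Let $\Gamma_N$ be the lattice of open subsets of $\mathbb{P}^{N-1}(\mathbb{Z}/2)$ generated by the sets $A_1,\ldots,A_N$ (with meet $\cap$ and join $\cup$), and let $\mathcal{A}_N$ be the set of antichains in $2^{\{1,\ldots,N\}}$, equipped with the operations $$l_1\wedge l_2=\min\{u_1\cup u_2\mid u_1\in l_1,\ u_2\in l_2\},\qquad l_1\vee l_2=\min(l_1\cup l_2).$$ Then $\mathcal{A}_N$ is a distributive lattice with meet $\wedge$ and join $\vee$, and the map $$L^{\Gamma_N}:\Gamma_N\rightarrow\mathcal{A}_N,\qquad L^{\Gamma_N}(U)=\min\big\{\{i_1,\ldots,i_k\}\subset\{1,\ldots,N\}\ \big|\ A_{i_1}\cap\ldots\cap A_{i_k}\subseteq U\big\},$$ is an isomorphism of distributive lattices, with inverse $(L^{\Gamma_N})^{-1}=R^{\Gamma_N}|_{\mathcal{A}_N}$, the restriction to $\mathcal{A}_N$ of the map $$R^{\Gamma_N}:2^{2^{\{1,\ldots,N\}}}\to\Gamma_N,\qquad R^{\Gamma_N}(l)=\bigcup_{\{i_1,\ldots,i_k\}\in l}(A_{i_1}\cap\ldots\cap A_{i_k}).$$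
   Context: The space $\mathbb{P}^{N-1}(\mathbb{Z}/2)$ is the set $\{0,1\}^N\setminus\{(0,\ldots,0)\}$ with the topology generated by (i.e. having as a subbasis) the subsets $A_i:=\{(z_1,\ldots,z_N)\in\mathbb{P}^{N-1}(\mathbb{Z}/2)\mid z_i\neq 0\}$, $i=1,\ldots,N$. Here $2^X$ denotes the set of all subsets of a set $X$. An antichain in $2^{\{1,\ldots,N\}}$ is a set of subsets of $\{1,\ldots,N\}$ no one of which is properly contained in another. For $l\subset 2^{\{1,\ldots,N\}}$, $\min l:=\{u\in l\mid \forall v\subsetneq u:\ v\notin l\}$ is the set of its inclusion-minimal elements, which is an antichain.
   Formalization: The antichain {∅} is excluded from A_N and the index sets in the definition of L are required nonempty (k ≥ 1), since otherwise the claim fails (N=1: two open sets but three antichains); Γ_N is taken to contain the empty set. *)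

(* Defs.v *)
From HB Require Import structures.
From mathcomp Require Import boolp classical_sets topology_structure.
(* After the classical layer, so that [set0], [setT], [setI], ... are those of
   [finset]. *)
From mathcomp Require Import all_boot.

Set Implicit Arguments.
Unset Strict Implicit.
Unset Printing Implicit Defensive.

Definition proj_space (N : nat) : Type :=
  {z : {ffun 'I_N -> bool} | z != [ffun=> false]}.

HB.instance Definition _ N := SubFinite.on (proj_space N).

Definition A_ (N : nat) (i : 'I_N) : {set proj_space N} :=
  [set z : proj_space N | val z i].

(* The topology with the sets [A_ i] as a subbasis. *)
HB.instance Definition _ N :=
  @isSubBaseTopological.Build (proj_space N) (set (proj_space N))
    (fun B => exists i : 'I_N, B = [set` A_ i]%classic) id.

Definition is_sublattice (T : finType) (F : {set {set T}}) : bool :=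
  [forall U in F, forall V in F, (U :&: V \in F) && (U :|: V \in F)].

(* The lattice generated by the [A_ i].  It contains the bottom element, i.e.
   the join of the empty family: [set0] is the image under [R_Gamma] of the
   empty antichain and is not obtained from the [A_ i] by binary operations
   alone. *)
Definition Gamma (N : nat) : {set {set proj_space N}} :=
  \bigcap_(F : {set {set proj_space N}} |
      [&& is_sublattice F, set0 \in F & [forall i : 'I_N, A_ i \in F]]) F.

Definition minimals (T : finType) (l : {set {set T}}) : {set {set T}} :=
  [set u in l | [forall v : {set T}, (v \proper u) ==> (v \notin l)]].

Definition is_antichain (T : finType) (l : {set {set T}}) : bool :=
  [forall u in l, forall v in l, ~~ (v \proper u)].

(* Antichains of nonempty index sets {i_1, ..., i_k}, k >= 1.  The condition
   [set0 \notin l] removes exactly one antichain, [[set set0]].  It has to be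
   removed: [R_Gamma [set set0]] is the whole space, which is also the image of
   the antichain of all singletons. *)
Definition antichains (N : nat) : {set {set {set 'I_N}}} :=
  [set l | is_antichain l & set0 \notin l].

Definition ac_meet (N : nat) (l1 l2 : {set {set 'I_N}}) : {set {set 'I_N}} :=
  minimals [set u1 :|: u2 | u1 in l1, u2 in l2].

Definition ac_join (N : nat) (l1 l2 : {set {set 'I_N}}) : {set {set 'I_N}} :=
  minimals (l1 :|: l2).

(* As above, k >= 1; otherwise the value at the whole space would be
   [[set set0]]. *)
Definition L_Gamma (N : nat) (U : {set proj_space N}) : {set {set 'I_N}} :=
  minimals [set u : {set 'I_N} | (u != set0) & \bigcap_(i in u) A_ i \subset U].

(* Defined on all families; for [u = set0] the intersection is the whole
   space. *)
Definition R_Gamma (N : nat) (l : {set {set 'I_N}}) : {set proj_space N} :=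
  \bigcup_(u in l) \bigcap_(i in u) A_ i.

(* The axioms of [Order.distrLatticeType] in algebraic form, relative to a
   subset [D] of the carrier. *)
Record distr_lattice_on (T : finType) (D : {set T}) (meet join : T -> T -> T) :
    Prop := DistrLatticeOn {
  dl_meet_closed : {in D &, forall x y, meet x y \in D};
  dl_join_closed : {in D &, forall x y, join x y \in D};
  dl_meetC : {in D &, commutative meet};
  dl_joinC : {in D &, commutative join};
  dl_meetA : {in D & &, associative meet};
  dl_joinA : {in D & &, associative join};
  dl_joinKI : {in D &, forall x y, meet x (join x y) = x};
  dl_meetKU : {in D &, forall x y, join x (meet x y) = x};
  dl_meetUl : {in D & &, left_distributive meet join};
  dl_joinIl : {in D & &, left_distributive join meet}
}.

Record lattice_iso_on (T T' : finType) (D : {set T}) (meet join : T -> T -> T)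
    (D' : {set T'}) (meet' join' : T' -> T' -> T') (f : T -> T') : Prop :=
  LatticeIsoOn {
  li_inj : {in D &, injective f};
  li_img : f @: D = D';
  li_meet : {in D &, {morph f : x y / meet x y >-> meet' x y}};
  li_join : {in D &, {morph f : x y / join x y >-> join' x y}}
}.

(* Main.v *)
(* Via z |-> supp z, the points of the space are the nonempty subsets of
   {1, ..., N}, and the intersection of the A_i over i in u is the set of points
   whose support contains u.  So the elements of Gamma are up-closed sets of
   points, R_Gamma l consists of the points lying above a member of l, and
   L_Gamma U lists the minimal supports of the points of U: this makes the two
   maps mutually inverse.  Since R_Gamma also turns the operations on antichains
   into intersection and union, the lattice laws of the antichains are pulled
   back along the injective map R_Gamma. *)
Require Import Defs.
From mathcomp Require Import boolp classical_sets topology_structure filter.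
From mathcomp Require Import all_boot.
Set Implicit Arguments.
Unset Strict Implicit.
Unset Printing Implicit Defensive.

(** * Minimal members of a family of finite sets, and antichains *)

Section Minimals.
Variable T : finType.
Implicit Types (l : {set {set T}}) (u v : {set T}).

Lemma minimals_sub l : minimals l \subset l.
Proof. by apply/subsetP => u; rewrite inE => /andP[]. Qed.

Lemma minimals_le l u : u \in l -> exists2 v, v \in minimals l & v \subset u.
Proof.
move=> ul; have [v /minsetP[vl vmin] vu] := minset_exists (P := fun v => v \in l) ul.
exists v => //; rewrite inE vl; apply/forallP => w; apply/implyP => wv.
by apply/negP => wl; move: (wv); rewrite (vmin w wl (proper_sub wv)) properxx.
Qed.

Lemma minimals_antichain l : is_antichain (minimals l).
Proof.
apply/forall_inP => u /[!inE]/andP[_ /forallP umin].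
apply/forall_inP => v /[!inE]/andP[vl _].
by apply/negP => vu; move: (umin v); rewrite vu vl.
Qed.

(** Descending from [u] in [l1] to [v] in [l2] and again to [w] in [l1] gives a chain [w], [v], [u]
    of inclusions; since [l1] is an antichain, [w = u], and so [u = v]. *)
Lemma eq_antichain l1 l2 : is_antichain l1 -> is_antichain l2 ->
    (forall u, u \in l1 -> exists2 v, v \in l2 & v \subset u) ->
    (forall u, u \in l2 -> exists2 v, v \in l1 & v \subset u) ->
  l1 = l2.
Proof.
move=> a1 a2 l12 l21.
wlog suff: l1 l2 a1 a2 l12 l21 / l1 \subset l2.
  by move=> sub; apply/eqP; rewrite eqEsubset !sub.
apply/subsetP => u ul; have [v vl vu] := l12 _ ul; have [w wl wv] := l21 _ vl.
have := forall_inP (forall_inP a1 _ ul) _ wl.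
rewrite properE (subset_trans wv vu) negbK => uw.
by have -> : u = v by apply/eqP; rewrite eqEsubset vu (subset_trans uw wv).
Qed.

End Minimals.

Section Gamma.
Variable N : nat.
Implicit Types (U V : {set proj_space N}) (u v : {set 'I_N}).
Implicit Types (l : {set {set 'I_N}}) (x y z : proj_space N).

(** * Supports of points and up-closed sets *)

Definition supp z : {set 'I_N} := [set i | val z i].

Lemma supp_neq0 z : supp z != set0.
Proof.
apply: contra (valP z) => /eqP s0; apply/eqP/ffunP => i; rewrite ffunE.
by have := in_set0 i; rewrite -s0 inE.
Qed.

(** Nonemptiness of [u] keeps its indicator function away from the removed zero vector. *)
Lemma supp_surj u : u != set0 -> exists z, supp z = u.
Proof.
case/set0Pn => i iu.
have uP : [ffun j => j \in u] != [ffun=> false].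
  by apply/eqP => /ffunP/(_ i); rewrite !ffunE iu.
by exists (exist _ [ffun j => j \in u] uP); apply/setP => j; rewrite inE ffunE.
Qed.

Lemma in_bigcapA u z : (z \in \bigcap_(i in u) A_ i) = (u \subset supp z).
Proof.
apply/bigcapP/subsetP => h i iu; first by have := h i iu; rewrite !inE.
by have := h i iu; rewrite !inE.
Qed.

Lemma in_R_Gamma l z :
  (z \in R_Gamma l) = [exists u in l, u \subset supp z].
Proof.
apply/bigcupP/exists_inP => [] [u ul]; first by rewrite in_bigcapA; exists u.
by exists u; rewrite ?in_bigcapA.
Qed.

Definition up_closed : {set {set proj_space N}} :=
  [set U : {set proj_space N} |
    [forall x in U, forall y : proj_space N, (supp x \subset supp y) ==> (y \in U)]].

Lemma up_closedP U :
  reflect (forall x y, supp x \subset supp y -> x \in U -> y \in U)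
          (U \in up_closed).
Proof.
rewrite inE; apply: (iffP forall_inP) => [h x y xy xU | h x xU].
  by have /forallP/(_ y)/implyP := h x xU; apply.
by apply/forallP => y; apply/implyP => xy; apply: h xU.
Qed.

(** For nonempty [u] the intersection has a least point, the one with support [u]; an up-closed [U]
    contains the intersection as soon as it contains that point or one below it. *)
Lemma bigcapA_sub U u : U \in up_closed -> u != set0 ->
  (\bigcap_(i in u) A_ i \subset U) = [exists z in U, supp z \subset u].
Proof.
move=> /up_closedP upU /supp_surj[w <-]; apply/subsetP/exists_inP.
  by move=> /(_ w); rewrite in_bigcapA subxx => /(_ isT) wU; exists w.
by case=> z zU zw y; rewrite in_bigcapA => wy; apply: upU zU; apply: subset_trans wy.
Qed.

(** * The generated lattice *)

(** Induction principle for [Gamma N], applied below to the families of up-closed and of open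
    sets. *)
Lemma Gamma_min (F : {set {set proj_space N}}) :
    (forall U V, U \in F -> V \in F -> U :&: V \in F) ->
    (forall U V, U \in F -> V \in F -> U :|: V \in F) ->
    set0 \in F -> (forall i, A_ i \in F) ->
  Gamma N \subset F.
Proof.
move=> FI FU F0 FA; apply: bigcap_inf; rewrite F0 /=; apply/andP; split.
  by do 2![apply/forall_inP => ? ?]; rewrite FI ?FU.
by apply/forallP.
Qed.

Lemma Gamma_setI U V : U \in Gamma N -> V \in Gamma N -> U :&: V \in Gamma N.
Proof.
move=> /bigcapP UG /bigcapP VG; apply/bigcapP => F FP.
by case/and3P: (FP) => /forall_inP/(_ _ (UG F FP))/forall_inP/(_ _ (VG F FP))/andP[].
Qed.

Lemma Gamma_setU U V : U \in Gamma N -> V \in Gamma N -> U :|: V \in Gamma N.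
Proof.
move=> /bigcapP UG /bigcapP VG; apply/bigcapP => F FP.
by case/and3P: (FP) => /forall_inP/(_ _ (UG F FP))/forall_inP/(_ _ (VG F FP))/andP[].
Qed.

Lemma Gamma_set0 : set0 \in Gamma N.
Proof. by apply/bigcapP => F /and3P[]. Qed.

Lemma Gamma_A i : A_ i \in Gamma N.
Proof. by apply/bigcapP => F /and3P[_ _ /forallP]. Qed.

(** Every support is nonempty, so the [A_ i] cover the space. In [Gamma_R] this handles the empty
    intersection. *)
Lemma Gamma_setT : [set: proj_space N] \in Gamma N.
Proof.
have <- : \bigcup_(i : 'I_N) A_ i = [set: proj_space N].
  apply/setP => z; rewrite inE; apply/bigcupP.
  by case/set0Pn: (supp_neq0 z) => i /[!inE] iz; exists i; rewrite ?inE.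
by elim/big_ind: _ => *; rewrite ?Gamma_set0 ?Gamma_setU ?Gamma_A.
Qed.

Lemma Gamma_R l : R_Gamma l \in Gamma N.
Proof.
apply: (big_ind (fun U => U \in Gamma N)) => [|U V|u _]; [exact: Gamma_set0 | exact: Gamma_setU |].
apply: (big_ind (fun U => U \in Gamma N)) => [|U V|i _]; [exact: Gamma_setT | exact: Gamma_setI |].
exact: Gamma_A.
Qed.

Lemma Gamma_up_closed : Gamma N \subset up_closed.
Proof.
apply: Gamma_min => [U V /up_closedP upU /up_closedP upV
  |U V /up_closedP upU /up_closedP upV| |i]; apply/up_closedP => x y xy.
- by rewrite !inE => /andP[/(upU _ _ xy)-> /(upV _ _ xy)->].
- by rewrite !inE => /orP[/(upU _ _ xy)->|/(upV _ _ xy)->]; rewrite ?orbT.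
- by rewrite inE.
- by have /implyP := subsetP xy i; rewrite !inE => /implyP.
Qed.

Lemma Gamma_open U : U \in Gamma N -> open [set` U]%classic.
Proof.
pose F := [set V : {set proj_space N} | `[< open [set` V]%classic >]].
suff /subsetP GF : Gamma N \subset F by move=> /GF; rewrite inE => /asboolP.
apply: Gamma_min => [V W|V W| |i]; rewrite !inE.
- move=> /asboolP oV /asboolP oW; apply/asboolP.
  have -> : [set` V :&: W]%classic = ([set` V] `&` [set` W])%classic.
    by apply/seteqP; split=> z /=; rewrite inE => /andP.
  exact: openI.
- move=> /asboolP oV /asboolP oW; apply/asboolP.
  have -> : [set` V :|: W]%classic = ([set` V] `|` [set` W])%classic.
    by apply/seteqP; split=> z /=; rewrite inE => /orP.
  exact: openU.
- apply/asboolP; have -> : [set` set0 : {set proj_space N}]%classic = classical_sets.set0.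
    by apply/seteqP; split=> z /=; rewrite ?inE.
  exact: open0.
- apply/asboolP.
  (* An open set is a union of finite intersections of subbasic sets; here both the union and the
     intersection have one term. *)
  exists [set [set` A_ i]]%classic.
    by move=> _ -> ; apply: finI_from1; exists i.
  by rewrite bigcup_set1.
Qed.

(** * The two maps are mutually inverse *)

Lemma L_GammaK : {in Gamma N, cancel (@L_Gamma N) (@R_Gamma N)}.
Proof.
move=> U /(subsetP Gamma_up_closed) upU; apply/setP => z; rewrite in_R_Gamma.
apply/exists_inP/idP => [[u /(subsetP (minimals_sub _))]|zU].
  by rewrite inE => /andP[_ /subsetP uU] uz; apply: uU; rewrite in_bigcapA.
(* The index set [supp z] is itself admissible for [U], so a minimal one lies below it. *)
apply: minimals_le; rewrite inE supp_neq0 bigcapA_sub ?supp_neq0 //.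
by apply/exists_inP; exists z.
Qed.

Lemma antichainsP l :
  reflect (is_antichain l /\ set0 \notin l) (l \in antichains N).
Proof. by rewrite inE; apply: andP. Qed.

Lemma minimals_antichains l : set0 \notin l -> minimals l \in antichains N.
Proof.
move=> l0; apply/antichainsP; split; first exact: minimals_antichain.
by apply: contra l0; apply/subsetP/minimals_sub.
Qed.

Lemma L_Gamma_antichains U : L_Gamma U \in antichains N.
Proof. by apply: minimals_antichains; rewrite !inE eqxx. Qed.

Lemma R_GammaK : {in antichains N, cancel (@R_Gamma N) (@L_Gamma N)}.
Proof.
move=> l /antichainsP[al l0].
have upR := subsetP Gamma_up_closed _ (Gamma_R l).
apply: eq_antichain al _ _; first exact: minimals_antichain.
- move=> u /(subsetP (minimals_sub _)) /[!inE]/andP[u0].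
  rewrite bigcapA_sub // => /exists_inP[z]; rewrite in_R_Gamma.
  by case/exists_inP=> v vl vz zu; exists v => //; apply: subset_trans zu.
- move=> u ul; apply: minimals_le.
  (* [L_Gamma] ranges over nonempty index sets only, hence the use of [set0 \notin l]. *)
  have u0 : u != set0 by apply: contraNneq l0 => <-.
  by rewrite inE u0; apply: bigcup_sup ul.
Qed.

(** * Transport of the operations along [R_Gamma] *)

Lemma R_Gamma_inj : {in antichains N &, injective (@R_Gamma N)}.
Proof. exact: can_in_inj R_GammaK. Qed.

(** Shrinking an index set enlarges its intersection, so the minimal index sets already give the
    whole union. *)
Lemma R_Gamma_minimals l : R_Gamma (minimals l) = R_Gamma l.
Proof.
apply/setP => z; rewrite !in_R_Gamma; apply/exists_inP/exists_inP => [] [u ul uz].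
  by exists u => //; apply: (subsetP (minimals_sub l)).
have [v vl vu] := minimals_le ul.
by exists v => //; apply: subset_trans uz.
Qed.

Lemma R_Gamma_join l1 l2 : R_Gamma (ac_join l1 l2) = R_Gamma l1 :|: R_Gamma l2.
Proof. by rewrite R_Gamma_minimals /R_Gamma bigcup_setU. Qed.

Lemma R_Gamma_meet l1 l2 : R_Gamma (ac_meet l1 l2) = R_Gamma l1 :&: R_Gamma l2.
Proof.
rewrite R_Gamma_minimals; apply/setP => z; rewrite inE !in_R_Gamma.
apply/exists_inP/andP => [[_ /imset2P[u v ul vl ->]]|].
  by rewrite subUset => /andP[uz vz]; split; apply/exists_inP; [exists u | exists v].
case=> /exists_inP[u ul uz] /exists_inP[v vl vz].
by exists (u :|: v); rewrite ?subUset ?uz ?imset2_f.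
Qed.

Lemma ac_join_closed : {in antichains N &, forall l1 l2, ac_join l1 l2 \in antichains N}.
Proof.
move=> l1 l2 /antichainsP[_ n1] /antichainsP[_ n2].
by apply: minimals_antichains; rewrite inE negb_or n1.
Qed.

Lemma ac_meet_closed : {in antichains N &, forall l1 l2, ac_meet l1 l2 \in antichains N}.
Proof.
move=> l1 l2 /antichainsP[_ n1] _; apply: minimals_antichains.
apply: contra n1 => /imset2P[u v ul _ /esym/eqP].
by rewrite setU_eq0 => /andP[/eqP <-].
Qed.

Lemma Gamma_distr_lattice :
  distr_lattice_on (Gamma N) (fun U V => U :&: V) (fun U V => U :|: V).
Proof.
split=> [U V|U V|U V _ _|U V _ _|U V W _ _ _|U V W _ _ _|U V _ _|U V _ _
  |U V W _ _ _|U V W _ _ _].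
- exact: Gamma_setI.
- exact: Gamma_setU.
- exact: setIC.
- exact: setUC.
- exact: setIA.
- exact: setUA.
- rewrite setIC; exact: setUK.
- rewrite setUC; exact: setIK.
- exact: setIUl.
- exact: setUIl.
Qed.

Lemma antichains_distr_lattice :
  distr_lattice_on (antichains N) (@ac_meet N) (@ac_join N).
Proof.
have cl := (ac_meet_closed, ac_join_closed).
have RE := (R_Gamma_meet, R_Gamma_join).
(* Both sides of each law are in [antichains N], so they can be compared through [R_Gamma], where
   the law is a set identity. *)
split; first [exact: ac_meet_closed | exact: ac_join_closed |
  move=> *; apply: R_Gamma_inj; rewrite ?cl // !RE].
- exact: setIC.
- exact: setUC.
- exact: setIA.
- exact: setUA.
- rewrite setIC; exact: setUK.
- rewrite setUC; exact: setIK.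
- exact: setIUl.
- exact: setUIl.
Qed.

Lemma L_Gamma_iso :
  lattice_iso_on (Gamma N) (fun U V => U :&: V) (fun U V => U :|: V)
    (antichains N) (@ac_meet N) (@ac_join N) (@L_Gamma N).
Proof.
have LA := L_Gamma_antichains.
split=> [||U V UG VG|U V UG VG].
- exact: (can_in_inj L_GammaK).
- apply/setP => l; apply/imsetP/idP => [[U _ ->]|lA]; first exact: LA.
  by exists (R_Gamma l); [exact: Gamma_R | rewrite R_GammaK].
(* Both sides have image [U :&: V] under [R_Gamma]. *)
- apply: R_Gamma_inj; rewrite ?ac_meet_closed ?LA //.
  by rewrite R_Gamma_meet !L_GammaK ?Gamma_setI.
- apply: R_Gamma_inj; rewrite ?ac_join_closed ?LA //.
  by rewrite R_Gamma_join !L_GammaK ?Gamma_setU.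
Qed.

End Gamma.

Theorem lemma4p4 (N : nat) :
  [/\ (* [Gamma N] is a distributive lattice of open subsets *)
      (forall U : {set proj_space N}, U \in Gamma N -> open [set` U]%classic)
      /\ distr_lattice_on (Gamma N) (fun U V => U :&: V) (fun U V => U :|: V),
      distr_lattice_on (antichains N) (@ac_meet N) (@ac_join N),
      lattice_iso_on (Gamma N) (fun U V => U :&: V) (fun U V => U :|: V)
        (antichains N) (@ac_meet N) (@ac_join N) (@L_Gamma N),
      (forall l : {set {set 'I_N}}, R_Gamma l \in Gamma N)
    & {in Gamma N, cancel (@L_Gamma N) (@R_Gamma N)} /\
      {in antichains N, cancel (@R_Gamma N) (@L_Gamma N)}].
Proof.
split.
- by split; [exact: Gamma_open | exact: Gamma_distr_lattice].
- exact: antichains_distr_lattice.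
- exact: L_Gamma_iso.
- exact: Gamma_R.
- by split; [exact: L_GammaK | exact: R_GammaK].
Qed.
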